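(* Let $p$ be a prime, $\Gamma$ a free group of finite rank $n>1$, $\bullet\in\{S,Z\}$ and $k\ge1$. The extension $$0\to\mathrm{Hom}(\mathcal N_1^\bullet,\mathcal L_{k+1}^\bullet)\xrightarrow{\ i\ }\mathrm{Aut}(\mathcal N_{k+1}^\bullet)\xrightarrow{\ \psi_k^\bullet\ }\mathrm{Aut}(\mathcal N_k^\bullet)\to1$$ is not central.
   Context: For a group $G$ with lower central series $G_1=G$, $G_k=[G,G_{k-1}]$ and a prime $p$: the Stallings mod-$p$ central series is $G_1^S=G$, $G_k^S=[G,G_{k-1}^S](G_{k-1}^S)^p$; the Zassenhaus mod-$p$ central series is $G_k^Z=\prod_{ip^j\ge k}(G_i)^{p^j}$. Here $H^m$ denotes the subgroup generated by $m$-th powers. For $\bullet\in\{S,Z\}$ set $\mathcal N_k^\bullet=\Gamma/\Gamma_{k+1}^\bullet$ and $\mathcal L_k^\bullet=\Gamma_k^\bullet/\Gamma_{k+1}^\bullet$. $\psi_k^\bullet$ is induced by the quotient $\mathcal N_{k+1}^\bullet\to\mathcal N_k^\bullet$ by the characteristic subgroup $\mathcal L_{k+1}^\bullet$, and $i(f)=(\gamma\mapsto f([\gamma])\gamma)$ with $[\gamma]$ the class of $\gamma$ in $\mathcal N_1^\bullet$; the displayed sequence is exact. An extension is central if the image of its kernel term is contained in the center of the middle group. *)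

(* Defs.v *)
From HB Require Import structures.
From mathcomp Require Import all_boot.
From mathcomp Require Import boolp classical_sets.

Set Implicit Arguments.
Unset Strict Implicit.
Unset Printing Implicit Defensive.

Local Open Scope classical_set_scope.
Local Open Scope group_scope.

(* Groups are the possibly infinite [groupType]s; subgroups are classical     *)
(* sets.                                                                      *)

Section Subgroups.
Variable G : groupType.

Definition is_subgroup (H : set G) : Prop :=
  [/\ H 1, forall x y, H x -> H y -> H (x * y) & forall x, H x -> H x^-1].

Definition is_normal (H : set G) : Prop := forall x y, H x -> H (x ^ y).

Definition gen (A : set G) : set G := smallest is_subgroup A.

Definition commutator_subgroup (A B : set G) : set G :=
  gen [set [~ x, y] | x in A & y in B].

Definition power_subgroup (A : set G) (m : nat) : set G :=
  gen [set x ^+ m | x in A].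

Definition set_mul (A B : set G) : set G := [set x * y | x in A & y in B].

Definition center : set G := [set x | forall y, commute x y].

Lemma sub_gen A : A `<=` gen A.
Proof. exact: sub_smallest. Qed.

Lemma gen_sub A (H : set G) : is_subgroup H -> A `<=` H -> gen A `<=` H.
Proof. by move=> sH sA; apply: smallest_sub. Qed.

Lemma gen_subgroup A : is_subgroup (gen A).
Proof.
split=> [H [[]//]|x y gx gy H HA|x gx H HA].
- by have [[_ HM _] _] := HA; apply: HM; [apply: gx | apply: gy].
- by have [[_ _ HV] _] := HA; apply: HV; apply: gx.
Qed.

Lemma gen_normal A : is_normal A -> is_normal (gen A).
Proof.
move=> nA x y gx; have [g1 gM gV] := gen_subgroup A.
apply: (gx [set z | gen A (z ^ y)]); split; last first.
  by move=> z /nA Azy; exact: sub_gen.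
split=> /= [|z t|z]; rewrite ?conj1g ?conjMg ?conjVg //; first exact: gM.
exact: gV.
Qed.

Lemma setT_subgroup : is_subgroup setT. Proof. by split. Qed.
Lemma setT_normal : is_normal setT. Proof. by []. Qed.

Lemma commutator_normal A : is_normal A -> is_normal (commutator_subgroup setT A).
Proof.
move=> nA; apply: gen_normal => _ y [u _ [v Av <-]].
by exists (u ^ y) => //; exists (v ^ y); [exact: nA | rewrite conjRg].
Qed.

Lemma power_normal A m : is_normal A -> is_normal (power_subgroup A m).
Proof.
move=> nA; apply: gen_normal => _ y [u Au <-].
by exists (u ^ y); [exact: nA | rewrite conjXg].
Qed.

Lemma set_mul_subgroup A B :
  is_subgroup A -> is_subgroup B -> is_normal B -> is_subgroup (set_mul A B).
Proof.
move=> [A1 AM AV] [B1 BM BV] nB; split.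
- by exists 1 => //; exists 1; rewrite ?mulg1.
- move=> _ _ [a Aa [b Bb <-]] [a' Aa' [b' Bb' <-]].
  exists (a * a'); first exact: AM.
  exists (b ^ a' * b'); first by apply: BM => //; apply: nB.
  by rewrite conjgE !mulgA -[a * a' * _]mulgA mulgV mulg1.
- move=> _ [a Aa [b Bb <-]]; exists a^-1; first exact: AV.
  exists (b^-1 ^ a^-1); first by apply/nB/BV.
  by rewrite conjgE invgK invgM !mulgA mulVg mul1g.
Qed.

Lemma set_mul_normal A B : is_normal A -> is_normal B -> is_normal (set_mul A B).
Proof.
move=> nA nB _ y [a Aa [b Bb <-]]; rewrite conjMg.
by exists (a ^ y); [exact: nA | exists (b ^ y) => //; exact: nB].
Qed.

End Subgroups.

(* [{multiplicative G -> H}] does not record f 1 = 1.                         *)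
Notation hom G H := (UMagmaMorphism.type G H).

Lemma gen_morph (G H : groupType) (f : hom G H)
    (A : set G) (B : set H) :
  (forall x, A x -> B (f x)) -> forall x, gen A x -> gen B (f x).
Proof.
move=> AB; have [b1 bM bV] := gen_subgroup B.
apply: (@gen_sub _ A (f @^-1` gen B)); last first.
  by move=> z /AB Bz; exact: sub_gen.
split=> /= [|z t|z]; rewrite ?gmulf1 ?gmulfM ?gmulfV //; first exact: bM.
exact: bV.
Qed.

Lemma gen_morph_onto (G H : groupType) (f : hom G H)
    (A : set G) (B : set H) :
  (forall y, B y -> exists2 x, A x & f x = y) ->
  forall y, gen B y -> exists2 x, gen A x & f x = y.
Proof.
move=> AB; have [a1 aM aV] := gen_subgroup A.
apply: (@gen_sub _ B (f @` gen A)).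
  split; first by exists 1 => //; rewrite gmulf1.
    move=> _ _ [x Ax <-] [x' Ax' <-].
    by exists (x * x'); [exact: aM | rewrite gmulfM].
  by move=> _ [x Ax <-]; exists x^-1; [exact: aV | rewrite gmulfV].
by move=> z /AB[x Ax <-]; exists x => //; exact: sub_gen.
Qed.

(* The series start at index 1; index 0 is a dummy equal to index 1.          *)

Fixpoint lower_central (G : groupType) (k : nat) : set G :=
  if k is (_.+1 as k').+1 then commutator_subgroup setT (@lower_central G k')
  else setT.
Arguments lower_central : clear implicits.

Inductive series_kind := Stallings | Zassenhaus.

Fixpoint stallings (p : nat) (G : groupType) (k : nat) : set G :=
  if k is (_.+1 as k').+1 then
    set_mul (commutator_subgroup setT (@stallings p G k'))
            (power_subgroup (@stallings p G k') p)
  else setT.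
Arguments stallings : clear implicits.

(* The product of an infinite family of normal subgroups is the subgroup      *)
(* generated by their union.                                                  *)
Definition zassenhaus (p : nat) (G : groupType) (k : nat) : set G :=
  gen [set x | exists i j : nat, [/\ (0 < i)%N, (k <= i * p ^ j)%N &
    power_subgroup (lower_central G i) (p ^ j) x]].
Arguments zassenhaus : clear implicits.

Definition central_series (b : series_kind) (p : nat) (G : groupType) (k : nat) :
  set G := if b is Stallings then stallings p G k else zassenhaus p G k.
Arguments central_series : clear implicits.

Section SeriesTheory.
Variables (b : series_kind) (p : nat).

Lemma lower_central_normal (G : groupType) k : is_normal (lower_central G k).
Proof. by elim: k => [|[|k] IH] //; exact: commutator_normal. Qed.

Lemma stallings_normal (G : groupType) k : is_normal (stallings p G k).
Proof.
elim: k => [|[|k] IH] //.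
by apply: set_mul_normal; [exact: commutator_normal | exact: power_normal].
Qed.

Lemma series_subgroup (G : groupType) k : is_subgroup (central_series b p G k).
Proof.
case: b => /=; last exact: gen_subgroup.
case: k => [|[|k]]; [exact: setT_subgroup..|].
apply: set_mul_subgroup; [exact: gen_subgroup..|].
exact (@power_normal G _ p (@stallings_normal G k.+1)).
Qed.

Lemma series_normal (G : groupType) k : is_normal (central_series b p G k).
Proof.
case: b => /=; first exact: stallings_normal.
apply: gen_normal => x y [i [j [i0 ij Hx]]]; exists i, j; split=> //.
by apply: power_normal Hx; exact: lower_central_normal.
Qed.

Lemma lower_central_morph (G H : groupType) (f : hom G H) k x :
  lower_central G k x -> lower_central H k (f x).
Proof.
elim: k x => [|[|k] IH] // x.
apply: gen_morph => _ [u _ [v /IH Hv <-]].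
by exists (f u) => //; exists (f v) => //; rewrite gmulfR.
Qed.

Lemma series_morph (G H : groupType) (f : hom G H) k x :
  central_series b p G k x -> central_series b p H k (f x).
Proof.
case: b => /=.
  elim: k x => [|[|k] IH] // _ [u Hu [v Hv <-]]; rewrite gmulfM.
  exists (f u).
    apply: gen_morph Hu => _ [w _ [t /IH Ht <-]].
    by exists (f w) => //; exists (f t) => //; rewrite gmulfR.
  exists (f v) => //; apply: gen_morph Hv => _ [w /IH Hw <-].
  by exists (f w) => //; rewrite gmulfXn.
apply: gen_morph => z [i [j [i0 ij Hz]]]; exists i, j; split=> //.
apply: gen_morph Hz => _ [w /lower_central_morph Hw <-].
by exists (f w) => //; rewrite gmulfXn.
Qed.

Section Onto.
Variables (G H : groupType) (f : hom G H).
Hypothesis f_onto : forall y, exists x, f x = y.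

Lemma commutator_onto (A : set G) (B : set H) :
  (forall y, B y -> exists2 x, A x & f x = y) ->
  forall y, commutator_subgroup setT B y ->
  exists2 x, commutator_subgroup setT A x & f x = y.
Proof.
move=> AB; apply: gen_morph_onto => _ [u _ [v /AB[t At <-] <-]].
have [w <-] := f_onto u.
by exists [~ w, t]; [exists w => //; exists t | rewrite gmulfR].
Qed.

Lemma power_onto m (A : set G) (B : set H) :
  (forall y, B y -> exists2 x, A x & f x = y) ->
  forall y, power_subgroup B m y -> exists2 x, power_subgroup A m x & f x = y.
Proof.
move=> AB; apply: gen_morph_onto => _ [u /AB[t At <-] <-].
by exists (t ^+ m); [exists t | rewrite gmulfXn].
Qed.

Lemma lower_central_onto k y :
  lower_central H k y -> exists2 x, lower_central G k x & f x = y.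
Proof.
elim: k y => [|[|k] IH] y; try by have [x <-] := f_onto y; exists x.
exact: commutator_onto.
Qed.

Lemma series_onto k y :
  central_series b p H k y -> exists2 x, central_series b p G k x & f x = y.
Proof.
case: b => /=.
  elim: k y => [|[|k] IH] y; try by have [x <-] := f_onto y; exists x.
  move=> [u /(commutator_onto IH)[u' Hu' <-] [v /(power_onto IH)[v' Hv' <-] <-]].
  by exists (u' * v'); [exists u' => //; exists v' | rewrite gmulfM].
apply: gen_morph_onto => z [i [j [i0 ij Hz]]].
have [x Hx <-] := power_onto (@lower_central_onto i) Hz.
by exists x => //; exists i, j.
Qed.

End Onto.
End SeriesTheory.

Record subgroup (G : groupType) := Subgroup {
  subgroup_set :> set G;
  subgroupP : is_subgroup subgroup_set }.

Record normal_subgroup (G : groupType) := NormalSubgroup {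
  normal_subgroup_subgroup :> subgroup G;
  normal_subgroupP : is_normal normal_subgroup_subgroup }.

Section SubgroupType.
Variables (G : groupType) (H : subgroup G).

Record subgroup_type := SubgroupType {
  subgroup_val :> G;
  subgroup_valP : subgroup_val \in (H : set G) }.

HB.instance Definition _ := [isSub for subgroup_val].
HB.instance Definition _ := [Choice of subgroup_type by <:].

Lemma subgroup_group_closed : group_closed [in (H : set G)].
Proof.
have [H1 HM HV] := subgroupP H; split; first exact: mem_set.
by move=> x y /set_mem Hx /set_mem Hy; apply/mem_set/HM => //; apply: HV.
Qed.

HB.instance Definition _ :=
  SubChoice_isSubGroup.Build G [in (H : set G)] subgroup_type
    subgroup_group_closed.

End SubgroupType.

Section Quotient.
Local Open Scope quotient_scope.
Variables (G : groupType) (N : normal_subgroup G).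

Definition coset_rel (x y : G) : bool := `[< (N : set G) (x^-1 * y) >].

Lemma coset_rel_refl : reflexive coset_rel.
Proof. by move=> x; apply/asboolP; rewrite mulVg; case: (subgroupP N). Qed.

Lemma coset_rel_sym : symmetric coset_rel.
Proof.
have [_ _ NV] := subgroupP N.
by move=> x y; apply/asboolP/asboolP => /NV; rewrite invgM invgK.
Qed.

Lemma coset_rel_trans : transitive coset_rel.
Proof.
have [_ NM _] := subgroupP N.
move=> y x z /asboolP Nxy /asboolP Nyz; apply/asboolP.
by rewrite -[z](mulVKg y) mulgA; exact: NM.
Qed.

Canonical coset_equiv :=
  EquivRel coset_rel coset_rel_refl coset_rel_sym coset_rel_trans.

Definition quotient : Type := {eq_quot coset_rel}.
HB.instance Definition _ := Choice.on quotient.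
HB.instance Definition _ := EqQuotient.on quotient.

Definition coset (x : G) : quotient := \pi_quotient x.

Lemma coset_eqP x y : coset x = coset y <-> (N : set G) (x^-1 * y).
Proof.
rewrite /coset; split => [/eqP|Nxy]; first by rewrite eqmodE => /asboolP.
by apply/eqP; rewrite eqmodE; apply/asboolP.
Qed.

Lemma coset_repr (u : quotient) : coset (repr u) = u.
Proof. exact: reprK. Qed.

Lemma coset_onto (u : quotient) : exists x, coset x = u.
Proof. by exists (repr u); exact: coset_repr. Qed.

Definition quotient_mul (u v : quotient) : quotient := coset (repr u * repr v).
Definition quotient_inv (u : quotient) : quotient := coset (repr u)^-1.

Lemma coset_mulE x y : quotient_mul (coset x) (coset y) = coset (x * y).
Proof.
have [_ NM _] := subgroupP N.
have /coset_eqP Nx := esym (coset_repr (coset x)).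
have /coset_eqP Ny := esym (coset_repr (coset y)).
apply/esym/coset_eqP.
have -> : (x * y)^-1 * (repr (coset x) * repr (coset y)) =
    (x^-1 * repr (coset x)) ^ y * (y^-1 * repr (coset y)).
  by rewrite conjgE invgM -!mulgA mulVKg.
by apply: NM => //; exact: normal_subgroupP.
Qed.

Lemma coset_invE x : quotient_inv (coset x) = coset x^-1.
Proof.
have [_ _ NV] := subgroupP N.
have /coset_eqP Nx := coset_repr (coset x).
apply/coset_eqP; rewrite invgK.
have -> : repr (coset x) * x^-1 = (x^-1 * repr (coset x)) ^ x^-1.
  by rewrite conjgE invgK !mulgA mulgV mul1g.
apply: normal_subgroupP.
by move: (NV _ Nx); rewrite invgM invgK.
Qed.

Lemma quotient_mulA : associative quotient_mul.
Proof.
move=> u v w; have [x <-] := coset_onto u; have [y <-] := coset_onto v.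
by have [z <-] := coset_onto w; rewrite !coset_mulE mulgA.
Qed.

Lemma quotient_mul1 : left_id (coset 1) quotient_mul.
Proof. by move=> u; have [x <-] := coset_onto u; rewrite coset_mulE mul1g. Qed.

Lemma quotient_1mul : right_id (coset 1) quotient_mul.
Proof. by move=> u; have [x <-] := coset_onto u; rewrite coset_mulE mulg1. Qed.

Lemma quotient_mulV : left_inverse (coset 1) quotient_inv quotient_mul.
Proof.
by move=> u; have [x <-] := coset_onto u; rewrite coset_invE coset_mulE mulVg.
Qed.

Lemma quotient_Vmul : right_inverse (coset 1) quotient_inv quotient_mul.
Proof.
by move=> u; have [x <-] := coset_onto u; rewrite coset_invE coset_mulE mulgV.
Qed.

HB.instance Definition _ := isGroup.Build quotient
  quotient_mulA quotient_mul1 quotient_1mul quotient_mulV quotient_Vmul.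

Lemma coset_is_morphism : monoid_morphism coset.
Proof. by split=> // x y; rewrite -coset_mulE. Qed.

HB.instance Definition _ := isUMagmaMorphism.Build G quotient coset
  coset_is_morphism.

End Quotient.

(* Automorphisms are recorded together with their inverse map.                *)
Record aut (G : groupType) := Aut {
  aut_hom :> hom G G;
  aut_inv : G -> G;
  aut_homK : cancel aut_hom aut_inv;
  aut_invK : cancel aut_inv aut_hom }.

Section Automorphisms.
Variable G : groupType.

Lemma hom_eqP (H : groupType) (f g : hom G H) : f =1 g -> f = g.
Proof.
case: f g => f [[f1] [fM]] [g [[g1] [gM]]] /= /funext fg; subst g.
by rewrite (Prop_irrelevance f1 g1) (Prop_irrelevance fM gM).
Qed.

Lemma aut_eqP (a b : aut G) : a =1 b -> a = b.
Proof.
case: a b => f f' fK f'K [g g' gK g'K] /= fg.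
have ? := hom_eqP fg; subst g.
have fg' : f' = g' by apply/funext => x; rewrite -{1}[x]g'K fK.
by subst g'; congr Aut; exact: Prop_irrelevance.
Qed.

HB.instance Definition _ := gen_eqMixin (aut G).
HB.instance Definition _ := gen_choiceMixin (aut G).

Definition aut_one : aut G := @Aut G idfun idfun (fun=> erefl) (fun=> erefl).

(* The product is composition: (a * b) x = a (b x).                           *)
Definition aut_mul (a b : aut G) : aut G :=
  @Aut G (a \o b) (aut_inv b \o aut_inv a)
    (can_comp (@aut_homK _ a) (@aut_homK _ b))
    (can_comp (@aut_invK _ b) (@aut_invK _ a)).

Lemma aut_inv_morphism (a : aut G) : monoid_morphism (aut_inv a).
Proof.
have a1 : a 1 = 1 by exact: gmulf1.
split; first by rewrite -[X in aut_inv a X]a1 aut_homK.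
by move=> x y; apply: (can_inj (@aut_homK _ a)); rewrite gmulfM !aut_invK.
Qed.

HB.instance Definition _ (a : aut G) :=
  isUMagmaMorphism.Build G G (aut_inv a) (aut_inv_morphism a).

Definition aut_opp (a : aut G) : aut G :=
  @Aut G (aut_inv a) a (@aut_invK _ a) (@aut_homK _ a).

Lemma aut_mulA : associative aut_mul.
Proof. by move=> a b c; exact: aut_eqP. Qed.
Lemma aut_mul1 : left_id aut_one aut_mul.
Proof. by move=> a; exact: aut_eqP. Qed.
Lemma aut_1mul : right_id aut_one aut_mul.
Proof. by move=> a; exact: aut_eqP. Qed.
Lemma aut_mulV : left_inverse aut_one aut_opp aut_mul.
Proof. by move=> a; apply: aut_eqP => x /=; rewrite aut_homK. Qed.
Lemma aut_Vmul : right_inverse aut_one aut_opp aut_mul.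
Proof. by move=> a; apply: aut_eqP => x /=; rewrite aut_invK. Qed.

HB.instance Definition _ := isGroup.Build (aut G)
  aut_mulA aut_mul1 aut_1mul aut_mulV aut_Vmul.

End Automorphisms.

(* H ranges over all groups, finite or infinite.                              *)
Definition free_basis (G : groupType) (n : nat) (x : 'I_n -> G) : Prop :=
  forall (H : groupType) (y : 'I_n -> H),
    exists f : hom G H,
      (forall i, f (x i) = y i) /\
      (forall g : hom G H, (forall i, g (x i) = y i) -> g = f).

Definition free_of_rank (G : groupType) (n : nat) : Prop :=
  exists x : 'I_n -> G, free_basis x.

Section AutSequence.
Variables (b : series_kind) (p : nat) (Gam : groupType).
Local Notation series := (central_series b p).

Lemma stallings_le (G : groupType) k : stallings p G k.+1 `<=` stallings p G k.
Proof.
case: k => [|k]; first exact: subset_refl.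
have [S1 SM SV] := series_subgroup Stallings p G k.+1.
have nS := @stallings_normal p G k.+1.
move=> _ [u Hu [v Hv <-]]; apply: (SM).
  apply: (gen_sub (And3 S1 SM SV)) Hu => _ [x _ [y Sy <-]].
  have -> : [~ x, y] = (y^-1) ^ x * y by rewrite !conjgE -!mulgA.
  by apply: (SM) => //; apply: nS; exact: SV.
apply: (gen_sub (And3 S1 SM SV)) Hv => _ [x Sx <-].
suff : forall m, stallings p G k.+1 (x ^+ m) by apply.
by elim=> [|m IH]; rewrite ?expg0 // expgS; exact: SM.
Qed.

Lemma series_le (G : groupType) k l : (l <= k)%N -> series G k `<=` series G l.
Proof.
case: b => /=.
  elim: k => [|k IH]; first by rewrite leqn0 => /eqP ->.
  rewrite leq_eqVlt => /orP[/eqP -> //|lk]; apply: subset_trans (IH lk).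
  exact: stallings_le.
move=> lk; apply: gen_sub; first exact: gen_subgroup.
move=> x [i [j [i0 ij Hx]]]; apply: sub_gen; exists i, j; split=> //.
exact: leq_trans ij.
Qed.

Definition series_nsub (k : nat) : normal_subgroup Gam :=
  @NormalSubgroup Gam (Subgroup (series_subgroup b p Gam k))
    (@series_normal b p Gam k).

Definition calN (k : nat) : groupType := quotient (series_nsub k.+1).

Definition cl (k : nat) : hom Gam (calN k) := coset (series_nsub k.+1).

Lemma cl_onto k (u : calN k) : exists x, cl k x = u.
Proof. exact: coset_onto. Qed.

Lemma cl_eqP k x y : cl k x = cl k y <-> series Gam k.+1 (x^-1 * y).
Proof. exact: coset_eqP. Qed.

Lemma image_subgroup (G H : groupType) (f : hom G H) (A : set G) :
  is_subgroup A -> is_subgroup (f @` A).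
Proof.
move=> [A1 AM AV]; split.
- by exists 1 => //; rewrite gmulf1.
- move=> _ _ [x Ax <-] [y Ay <-].
  by exists (x * y); [exact: AM | rewrite gmulfM].
- by move=> _ [x Ax <-]; exists x^-1; [exact: AV | rewrite gmulfV].
Qed.

(* Gamma_k / Gamma_(k+1), as a subgroup of N_k = Gamma / Gamma_(k+1).         *)
Definition calL (k : nat) : subgroup (calN k) :=
  Subgroup (image_subgroup (cl k) (series_subgroup b p Gam k)).

(* The quotient map, only meant for l <= k.                                   *)
Definition proj (k l : nat) (u : calN k) : calN l :=
  cl l (repr (u : quotient (series_nsub k.+1))).

Lemma proj_cl k l x : (l <= k)%N -> proj l (cl k x) = cl l x.
Proof.
move=> lk; apply/cl_eqP/(@series_le Gam k.+1) => //.
by apply/cl_eqP; exact: coset_repr.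
Qed.

Lemma calLE k (u : calN k) :
  (calL k : set (calN k)) u <-> series (calN k) k u.
Proof.
split=> [[x Hx <-]|]; first exact: series_morph.
by move=> /(series_onto (@cl_onto k)).
Qed.

Lemma calL_char k (a : aut (calN k)) u :
  (calL k : set (calN k)) u -> (calL k : set (calN k)) (a u).
Proof. by move=> /calLE Hu; apply/calLE; exact: series_morph. Qed.

Lemma proj_eqP k (u v : calN k.+1) :
  proj k u = proj k v <-> (calL k.+1 : set (calN k.+1)) (u^-1 * v).
Proof.
have [x <-] := cl_onto u; have [y <-] := cl_onto v.
rewrite !proj_cl // -gmulfV -gmulfM; split=> [/cl_eqP xy|].
  by exists (x^-1 * y).
move=> [z Hz /cl_eqP /(series_le (leqnSn _)) zxy]; apply/cl_eqP.
have [_ SM _] := series_subgroup b p Gam k.+1.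
by rewrite -[x^-1 * y](mulVKg z); exact: SM.
Qed.

Lemma proj_aut k (a : aut (calN k.+1)) u v :
  proj k u = proj k v -> proj k (a u) = proj k (a v).
Proof.
by move=> /proj_eqP uv; apply/proj_eqP; rewrite -gmulfV -gmulfM; exact: calL_char.
Qed.

Definition psi_fun k (a : aut (calN k.+1)) (u : calN k) : calN k :=
  proj k (a (cl k.+1 (repr (u : quotient (series_nsub k.+1))))).

Lemma psi_funE k (a : aut (calN k.+1)) v :
  psi_fun a (proj k v) = proj k (a v).
Proof.
rewrite /psi_fun; apply: proj_aut; rewrite proj_cl //; exact: coset_repr.
Qed.

Lemma proj_onto k (u : calN k) : exists v : calN k.+1, proj k v = u.
Proof.
by have [x <-] := cl_onto u; exists (cl k.+1 x); rewrite proj_cl.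
Qed.

Lemma projM k (u v : calN k.+1) : proj k (u * v) = proj k u * proj k v.
Proof.
have [x <-] := cl_onto u; have [y <-] := cl_onto v.
by rewrite -gmulfM !proj_cl // gmulfM.
Qed.

Lemma psi_fun_morphism k (a : aut (calN k.+1)) : monoid_morphism (psi_fun a).
Proof.
split.
  have <- : proj k (1 : calN k.+1) = 1.
    have <- : cl k.+1 1 = 1 by exact: gmulf1.
    by rewrite proj_cl // gmulf1.
  by rewrite psi_funE gmulf1.
move=> u v; have [x <-] := proj_onto u; have [y <-] := proj_onto v.
by rewrite -projM !psi_funE gmulfM projM.
Qed.

HB.instance Definition _ k (a : aut (calN k.+1)) :=
  isUMagmaMorphism.Build (calN k) (calN k) (psi_fun a) (psi_fun_morphism a).

Lemma psi_funK k (a : aut (calN k.+1)) : cancel (psi_fun a) (psi_fun a^-1).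
Proof.
move=> u; have [x <-] := proj_onto u.
by rewrite !psi_funE; congr proj; exact: aut_homK.
Qed.

Lemma psi_funVK k (a : aut (calN k.+1)) : cancel (psi_fun a^-1) (psi_fun a).
Proof.
move=> u; have [x <-] := proj_onto u.
by rewrite !psi_funE; congr proj; exact: aut_invK.
Qed.

Definition psi k (a : aut (calN k.+1)) : aut (calN k) :=
  @Aut (calN k) (psi_fun a) (psi_fun a^-1) (@psi_funK k a) (@psi_funVK k a).

Lemma psi_morphism k : monoid_morphism (@psi k).
Proof.
split=> [|a a']; apply: aut_eqP => u; have [x <-] := proj_onto u.
  by rewrite /= psi_funE.
by rewrite /= !psi_funE.
Qed.

HB.instance Definition _ k :=
  isUMagmaMorphism.Build (aut (calN k.+1)) (aut (calN k)) (@psi k)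
    (psi_morphism k).

Definition ker_hom (k : nat) : Type := hom (calN 1) (subgroup_type (calL k.+1)).

Definition incl_fun k (f : ker_hom k) (u : calN k.+1) : calN k.+1 :=
  subgroup_val (f (proj 1 u)) * u.

(* [incl f] is the automorphism whose underlying map is [incl_fun f].  That   *)
(* [incl_fun f] is an automorphism rests on the centrality of both series,    *)
(* which is not proved here; the value 1 of the total function [incl] when    *)
(* there is no such automorphism is central, so it cannot be responsible for  *)
(* a failure of centrality of the extension.                                  *)
Definition incl k (f : ker_hom k) : aut (calN k.+1) :=
  if pselect (exists a : aut (calN k.+1), a =1 incl_fun f) is left h
  then projT1 (cid h) else 1.

Lemma inclE k (f : ker_hom k) (a : aut (calN k.+1)) :
  a =1 incl_fun f -> incl f = a.
Proof.
move=> af; rewrite /incl; case: pselect => [h|[]]; last by exists a.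
by case: (cid h) => a' /= a'f; apply: aut_eqP => u; rewrite a'f af.
Qed.

End AutSequence.

(* The two maps of an extension A -> E -> Q; the pointwise group structure of *)
(* the kernel term A plays no role in centrality.                             *)
Record extension_maps (A : Type) (E Q : groupType) := ExtensionMaps {
  ext_in : A -> E;
  ext_out : hom E Q }.

Definition central_extension A E Q (X : extension_maps A E Q) : Prop :=
  range (ext_in X) `<=` center (G := E).

Definition aut_extension (b : series_kind) (p : nat) (Gam : groupType) (k : nat) :
    extension_maps (ker_hom b p Gam k) (aut (calN b p Gam k.+1))
      (aut (calN b p Gam k)) :=
  ExtensionMaps (@incl b p Gam k) (@psi b p Gam k).

(* Main.v *)
(* Let c be the iterated commutator [x_1, [x_1, ..., [x_1, x_0]]] of weight   *)
(* k + 1 in two distinct basis elements.  Both series contain the lower       *)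
(* central series, so the class u of c in N_(k+1) is central of exponent p,   *)
(* and there is f : N_1 -> L_(k+1) sending x_0 to u and the other basis       *)
(* elements to 1.  If i(f) commuted with the automorphism t exchanging x_0    *)
(* and x_1, then t u = f (t x_0) = f x_1 = 1, so u = 1.  But c survives       *)
(* modulo the (k+2)-nd term of either series: in the unitriangular group of   *)
(* size k + 2 over F_p, filtered by the distance to the diagonal, that term   *)
(* is trivial, while c can be sent to 1 +- E_(0,k+1).                         *)

From HB Require Import structures.
From mathcomp Require Import all_boot all_fingroup all_algebra.
From mathcomp Require Import boolp classical_sets.
From Pilot Require Import Defs.

Set Implicit Arguments.
Unset Strict Implicit.
Unset Printing Implicit Defensive.

Import GRing.Theory.
Local Open Scope classical_set_scope.
Local Open Scope group_scope.

(** Centrality already fails for one kernel element and one automorphism. Let f send the class of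
    x_0 to the class u of the weight k + 1 commutator c, and the class of x_1 to 1
    ([tower_translation]). Let t be induced by exchanging x_0 and x_1 ([free_basis_perm],
    [involution_aut]). Evaluation at x_0 shows that i(f) and t commute only if t u = 1, that is,
    only if c lies in the term of index k + 2. [tower_not_in_series] excludes this. By
    [unitri_tower_neq1], c can be sent to a non-identity unitriangular matrix over F_p. By
    [series_sub_filtration], that term is trivial in the unitriangular group, because distance to
    the diagonal grows under commutators and is multiplied by p under p-th powers. *)

(** * Bounds for the two series from above and below *)

(** Induction on the index: a Stallings step uses i + 1 <= i p for i > 0, and j successive p-th
    powers carry [D i] into [D (i * p ^ j)] for the Zassenhaus series. *)
Lemma series_sub_filtration (b : series_kind) (p : nat) (G : groupType)
    (D : nat -> set G) :
  prime p -> (forall i, is_subgroup (D i)) -> (forall x, D 1%N x) ->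
  (forall i j, (i <= j)%N -> D j `<=` D i) ->
  (forall i x y, D i y -> D i.+1 [~ x, y]) ->
  (forall i x, D i x -> D (i * p)%N (x ^+ p)) ->
  forall k, central_series b p G k `<=` D k.
Proof.
move=> p_pr sD D1 leD commD powD; case: b => /=.
  elim=> [|[|k] IH] x; [by move=> _; apply: (leD 0 1)%N | by []|].
  have [_ DM _] := sD k.+2; move=> [u Hu [v Hv <-]]; apply: (DM).
    by apply: (gen_sub (sD _)) Hu => _ [y _ [z /IH Dz <-]]; exact: commD.
  apply: (gen_sub (sD _)) Hv => _ [y /IH Dy <-].
  by apply: leD (powD _ _ Dy); rewrite ltn_Pmulr ?prime_gt1.
have lcD i : lower_central G i `<=` D i.
  elim: i => [|[|i] IH] x; [by move=> _; apply: (leD 0 1)%N | by []|].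
  apply: (gen_sub (sD _)) => _ [y _ [z /IH Dz <-]]; exact: commD.
move=> k; apply: (gen_sub (sD _)) => x [i [j [i0 /leD kij]]].
apply: (gen_sub (sD _)) => _ [y /lcD Dy <-]; apply: kij.
elim: j => [|j IH]; first by rewrite muln1.
by rewrite expnSr mulnA expgnA; exact: powD.
Qed.

Lemma lower_central_sub_series b p G k :
  lower_central G k `<=` central_series b p G k.
Proof.
case: b => /=.
  elim: k => [|[|k] IH] // x Hx; exists x; last first.
    exists 1; last by rewrite mulg1.
    by have [] := gen_subgroup [set y ^+ p | y in stallings p G k.+1].
  apply: (gen_sub (gen_subgroup _)) Hx => _ [u _ [v /IH Hv <-]].
  by apply: sub_gen; exists u => //; exists v.
move=> x Hx; apply: sub_gen; case: k Hx => [|k] Hx.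
  by exists 1%N, 0%N; split=> //; apply: sub_gen; exists x.
exists k.+1, 0%N; split=> //; first by rewrite muln1.
by apply: sub_gen; exists x.
Qed.

(** This makes the class of c in N_(k+1) have exponent p. *)
Lemma lower_central_pow_series b p G k x :
  (1 < p)%N -> (0 < k)%N -> lower_central G k x ->
  central_series b p G k.+1 (x ^+ p).
Proof.
move=> p_gt1; case: k => // k _ Hx; case: b => /=.
  exists 1; first by have [] := gen_subgroup [set [~ y, z] | y in setT &
    z in stallings p G k.+1].
  exists (x ^+ p); last by rewrite mul1g.
  apply: sub_gen; exists x => //.
  exact: (@lower_central_sub_series Stallings p G k.+1 x Hx).
apply: sub_gen; exists k.+1, 1%N; split=> //.
  by rewrite expn1 ltn_Pmulr.
by rewrite expn1; apply: sub_gen; exists x.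
Qed.

(** * Homomorphisms out of quotients and free groups *)

Lemma quotient_hom (G H : groupType) (N : normal_subgroup G)
    (f : Defs.hom G H) :
  (forall x, (N : set G) x -> f x = 1) ->
  exists g : Defs.hom (Defs.quotient N) H, forall x, g (Defs.coset N x) = f x.
Proof.
move=> fN; pose g (u : Defs.quotient N) := f (generic_quotient.repr u).
have gE x : g (Defs.coset N x) = f x.
  have /coset_eqP/fN := Defs.coset_repr (Defs.coset N x).
  by rewrite gmulfM gmulfV => /(canRL (mulVKg _)); rewrite mulg1.
have gM : monoid.monoid_morphism g.
  split; first exact: etrans (gE 1) gmulf1.
  move=> u v; have [x <-] := coset_onto u; have [y <-] := coset_onto v.
  by rewrite -gmulfM !gE gmulfM.
pose gm := isUMagmaMorphism.Build _ _ g gM.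
by exists (HB.pack_for (Defs.hom (Defs.quotient N) H) g gm).
Qed.

Section FreeBasis.
Variables (G : groupType) (n : nat) (x : 'I_n -> G) (bx : free_basis x).

Lemma free_basis_ext (H : groupType) (f g : Defs.hom G H) :
  (forall i, f (x i) = g (x i)) -> f = g.
Proof.
move=> fg; have [h [_ hu]] := @bx H (fun i => g (x i)).
have fh : f = h.
  by apply: hu; exact: fg.
have gh : g = h by apply: hu.
by rewrite fh gh.
Qed.

Lemma free_basis_perm (s : 'I_n -> 'I_n) : involutive s ->
  exists2 f : Defs.hom G G, involutive f & forall i, f (x i) = x (s i).
Proof.
move=> sK; have [f [fx _]] := bx (x \o s); exists f => // y.
have ff : (f \o f : Defs.hom G G) = (idfun : Defs.hom G G).
  by apply: free_basis_ext => i; rewrite /= fx /= fx /= sK.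
exact: (congr1 (fun g : Defs.hom G G => g y) ff).
Qed.

End FreeBasis.

(** * Powers and commutators of ring elements 1 + A *)

Section Rings.
Local Open Scope ring_scope.

Lemma expr1D_pchar (R : nzRingType) (p : nat) (A : R) :
  p \in GRing.pchar R -> (1 + A) ^+ p = 1 + A ^+ p.
Proof.
move=> pR; rewrite -!(pFrobenius_autE pR) pFrobenius_autD_comm.
  by rewrite pFrobenius_aut1.
by apply/commr_sym/commr1.
Qed.

Lemma mulr_commutator1D (R : nzRingType) (A B : R) :
  (1 + A) * (1 + B) - (1 + B) * (1 + A) = A * B - B * A.
Proof.
rewrite !mulrDl !mulrDr !mul1r !mulr1 [1 + B + _]addrACA.
by rewrite opprD [LHS]addrACA subrr add0r opprD addrACA subrr add0r.
Qed.

(** Equivalently g h = h g (1 - X N): both sides expand to 1 + N + X. *)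
Lemma unit_commg_val (R : finUnitRingType) (g h : {unit R}) (X N : R) :
  val g = 1 + N -> val h = 1 + X -> N * X = 0 -> X * X = 0 ->
  val [~ g, h]%g = 1 - X * N.
Proof.
move=> gN hX NX XX.
have E : val (g * h)%g = val (h * g)%g * (1 - X * N).
  rewrite !FinRing.val_unitM gN hX -mulrA.
  have -> : (1 + N) * (1 - X * N) = 1 + N - X * N.
    by rewrite mulrBr mulr1 mulrDl mul1r mulrA NX mul0r addr0.
  have XY : X * (1 + N - X * N) = X + X * N.
    by rewrite mulrBr mulrDr mulr1 mulrA XX mul0r subr0.
  by rewrite [RHS]mulrDl mul1r XY [X + _]addrC addrA subrK mulrDr mulr1 mulrDl
    NX mul1r addr0.
have -> : [~ g, h]%g = ((h * g)^-1 * (g * h))%g.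
  by rewrite commgEl conjgE invgM !mulgA.
by rewrite FinRing.val_unitM E mulrA -FinRing.val_unitM mulVg mul1r.
Qed.

End Rings.

(** * Matrices filtered by distance to the diagonal *)

Section DiagonalFiltration.
Local Open Scope ring_scope.
Variables (F : nzRingType) (m : nat).
Local Notation R := ('M[F]_m.+1).

Definition diag_ge (i : nat) : set R :=
  [set A | forall a c : 'I_m.+1, (c < a + i)%N -> A a c = 0].

Lemma diag_geM i j (A B : R) :
  diag_ge i A -> diag_ge j B -> diag_ge (i + j) (A * B).
Proof.
move=> HA HB a c lt_c; rewrite mxE big1 // => e _.
case: (ltnP e (a + i)) => [/HA -> | le_e]; first by rewrite mul0r.
by rewrite HB ?mulr0 // (leq_trans lt_c) // addnA leq_add2r.
Qed.

Lemma diag_ge0 i : diag_ge i 0. Proof. by move=> a c _; rewrite mxE. Qed.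

Lemma diag_ge1 : diag_ge 0 1.
Proof.
by move=> a c; rewrite addn0 mxE => ca; rewrite -val_eqE /= gtn_eqF.
Qed.

Lemma diag_geD i (A B : R) : diag_ge i A -> diag_ge i B -> diag_ge i (A + B).
Proof. by move=> HA HB a c h; rewrite mxE HA ?HB ?addr0. Qed.

Lemma diag_geN i (A : R) : diag_ge i A -> diag_ge i (- A).
Proof. by move=> HA a c h; rewrite mxE HA ?oppr0. Qed.

Lemma diag_ge_le i j : (i <= j)%N -> diag_ge j `<=` diag_ge i.
Proof.
by move=> ij A HA a c h; apply: HA; rewrite (leq_trans h) ?leq_add2l.
Qed.

Lemma diag_geX i k (A : R) : diag_ge i A -> diag_ge (i * k) (A ^+ k).
Proof.
move=> HA; elim: k => [|k IH]; first by rewrite muln0; exact: diag_ge1.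
by rewrite exprS mulnS; exact: diag_geM.
Qed.

Lemma diag_ge_eq0 (A : R) i : (m < i)%N -> diag_ge i A -> A = 0.
Proof.
move=> mi HA; apply/matrixP => a c; rewrite mxE HA //.
exact: leq_trans (ltn_ord c) (leq_trans mi (leq_addl _ _)).
Qed.

(** The nilpotent Jordan block. *)
Definition shift_mx : R := \matrix_(a, c) (c == a.+1 :> nat)%:R.

Lemma delta_shift (a j : 'I_m.+1) : (j < m)%N ->
  delta_mx a j * shift_mx = delta_mx a (inord j.+1) :> R.
Proof.
move=> jm; apply/matrixP => b c; rewrite !mxE (bigD1 j) //= big1 ?addr0.
  rewrite !mxE eqxx andbT /= -natrM mulnb -(val_eqE c) /= inordK //.
by move=> e ej; rewrite !mxE (negPf ej) andbF mul0r.
Qed.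

Lemma shift_delta (j : 'I_m.+1) : shift_mx * delta_mx ord0 j = 0 :> R.
Proof.
apply/matrixP => b c; rewrite !mxE big1 // => e _; rewrite !mxE.
by case: (eqVneq e ord0) => [->|] //=; rewrite ?mul0r ?mulr0.
Qed.

End DiagonalFiltration.

(** * The induced filtration on invertible matrices over F_p *)

Section Unitri.
Local Open Scope ring_scope.
Variables (p m : nat).
Hypothesis p_prime : prime p.
Local Notation R := ('M['F_p]_m.+1).

Lemma pchar_mx_Fp : p \in GRing.pchar R.
Proof.
by apply: (rmorph_pchar (scalar_mx : {rmorphism 'F_p -> R})); exact: pchar_Fp.
Qed.

(** Index 0 gives the invertible upper triangular matrices, index 1 the unitriangular group. *)
Definition unitri_set (i : nat) : set {unit R} :=
  [set g | diag_ge i (val g - 1)].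

Lemma unitri_set_diag i g : unitri_set i g -> diag_ge 0 (val g).
Proof.
move=> Hg; rewrite -[val g](subrK 1); apply: diag_geD; last exact: diag_ge1.
exact: diag_ge_le Hg.
Qed.

Lemma unitri_setX i k g : unitri_set i g -> unitri_set i (g ^+ k)%g.
Proof.
rewrite /unitri_set /= => Hg.
have H0 := unitri_set_diag Hg.
elim: k => [|k IH].
  by rewrite FinRing.val_unitX expr0 subrr; exact: diag_ge0.
rewrite expgS FinRing.val_unitM.
have -> : val g * val (g ^+ k)%g - 1 =
    val g * (val (g ^+ k)%g - 1) + (val g - 1).
  by rewrite mulrBr mulr1 addrA subrK.
by apply: diag_geD => //; have := diag_geM H0 IH; rewrite add0n.
Qed.

(** In a finite group an inverse is a power. *)
Lemma unitri_setV i g : unitri_set i g -> unitri_set i g^-1%g.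
Proof. by rewrite invg_expg; exact: unitri_setX. Qed.

Lemma unitri_set_subgroup i : is_subgroup (unitri_set i).
Proof.
split=> [|g h Hg Hh|]; last exact: unitri_setV.
  by rewrite /unitri_set /= subrr; exact: diag_ge0.
rewrite /unitri_set /=.
have -> : val g * val h - 1 = val g * (val h - 1) + (val g - 1).
  by rewrite mulrBr mulr1 addrA subrK.
apply: diag_geD => //.
by have := diag_geM (unitri_set_diag Hg) Hh; rewrite add0n.
Qed.

(** [g, h] - 1 = g^-1 h^-1 (g h - h g), and g h - h g is the additive commutator of g - 1 and h -
    1. *)
Lemma unitri_set_commg i j g h :
  unitri_set i g -> unitri_set j h -> unitri_set (i + j) [~ g, h]%g.
Proof.
move=> Hg Hh; rewrite /unitri_set /=.
have Vg := unitri_set_diag (unitri_setV Hg).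
have Vh := unitri_set_diag (unitri_setV Hh).
have -> : val [~ g, h]%g - 1 = val g^-1%g * val h^-1%g *
    ((val g - 1) * (val h - 1) - (val h - 1) * (val g - 1)).
  rewrite -mulr_commutator1D ![1 + (_ - 1)]addrC !subrK.
  rewrite mulrBr !mulrA -!FinRing.val_unitM mulgKV mulVg.
  by rewrite commgEl conjgE !mulgA.
rewrite -[(i + j)%N]add0n; apply: diag_geM; first exact: diag_geM Vg Vh.
apply: diag_geD; first exact: diag_geM.
by apply: diag_geN; rewrite addnC; exact: diag_geM.
Qed.

(** In characteristic p, g^p - 1 = (g - 1)^p. *)
Lemma unitri_set_pow i g : unitri_set i g -> unitri_set (i * p) (g ^+ p)%g.
Proof.
move=> Hg; rewrite /unitri_set /= FinRing.val_unitX.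
rewrite -[val g](subrK 1) [_ + 1]addrC expr1D_pchar ?pchar_mx_Fp //.
by rewrite addrC addKr; exact: diag_geX.
Qed.

(** A is nilpotent, so by Frobenius a p-power of 1 + A equals 1. *)
Lemma unit_add1 (A : R) : diag_ge 1 A -> 1 + A \is a GRing.unit.
Proof.
move=> HA; have pk k : (1 + A) ^+ (p ^ k) = 1 + A ^+ (p ^ k).
  elim: k => [|k IH]; rewrite ?expr1 // expnSr !exprM IH.
  exact/expr1D_pchar/pchar_mx_Fp.
rewrite -(@unitrX_pos _ _ (p ^ m.+1)%N) ?expn_gt0 ?prime_gt0 // pk.
rewrite (@diag_ge_eq0 _ _ (A ^+ (p ^ m.+1)) (p ^ m.+1)%N) ?addr0 ?unitr1 //.
  by rewrite (ltn_trans _ (ltn_expl _ _)) ?prime_gt1.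
by rewrite -[X in diag_ge X](mul1n (p ^ m.+1)%N); exact: diag_geX.
Qed.

End Unitri.

(** * The iterated commutator and its survival *)

Fixpoint commutator_tower (G : groupType) (x y : G) (j : nat) : G :=
  if j is i.+1 then [~ y, commutator_tower x y i] else x.

Lemma commutator_tower_lower_central (G : groupType) (x y : G) j :
  lower_central G j.+1 (commutator_tower x y j).
Proof.
elim: j => [|j IH] //; apply: sub_gen; exists y => //.
by exists (commutator_tower x y j).
Qed.

Lemma commutator_tower_morph (G H : groupType) (f : Defs.hom G H) (x y : G) j :
  f (commutator_tower x y j) = commutator_tower (f x) (f y) j.
Proof. by elim: j => [|j IH] //=; rewrite gmulfR IH. Qed.

Section Tower.
Local Open Scope ring_scope.
Variables (p k : nat).
Hypothesis p_prime : prime p.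
Local Notation R := ('M['F_p]_k.+2).

(** For x = 1 + E_(0,1) and y = 1 + [shift_mx], each commutator with y moves the off-diagonal entry
    one column to the right and flips its sign. After k steps it sits in the corner (0, k+1). *)
Lemma unitri_tower_neq1 : exists x y : {unit R},
  [/\ unitri_set 1 x, unitri_set 1 y & commutator_tower x y k <> 1%g].
Proof.
pose e : R := delta_mx ord0 (inord 1).
have e1 : diag_ge 1 e.
  move=> a c; rewrite addn1 ltnS mxE => ca.
  by case: eqP ca => //= ->; case: eqP => //= ->; rewrite inordK.
have s1 : diag_ge 1 (shift_mx 'F_p k.+1).
  move=> a c; rewrite addn1 mxE => ca.
  by rewrite (ltn_eqF ca).
pose x := FinRing.unit R (unit_add1 p_prime e1).
pose y := FinRing.unit R (unit_add1 p_prime s1).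
exists x, y; split; [by rewrite /unitri_set /= addrC addKr..|].
have towerE j : (j <= k)%N -> val (commutator_tower x y j) =
    1 + (-1) ^+ j *: delta_mx ord0 (inord j.+1).
  elim: j => [|j IH] jk; first by rewrite expr0 scale1r.
  have jS : (inord j.+1 : 'I_k.+2) = j.+1 :> nat by rewrite inordK ?ltnS 1?ltnW.
  have -> := @unit_commg_val _ y (commutator_tower x y j) _ _ erefl
    (IH (ltnW jk)).
  - rewrite -scalerAl delta_shift jS ?ltnS //.
    by rewrite exprS mulN1r scaleNr.
  - by rewrite -scalerAr shift_delta scaler0.
  - rewrite -scalerAl -scalerAr -mulmxE mul_delta_mx_0 ?scaler0 //.
    by rewrite -val_eqE /= jS.
move=> /(congr1 val); rewrite towerE // => /(canRL (addKr _)).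
rewrite addNr => /matrixP /(_ ord0 (inord k.+1)) /eqP.
by rewrite !mxE !eqxx mulr1 signr_eq0.
Qed.

End Tower.

Lemma tower_not_in_series (b : series_kind) (p n : nat) (Gam : groupType)
    (x : 'I_n -> Gam) (i0 i1 : 'I_n) (k : nat) :
  prime p -> free_basis x -> i1 != i0 ->
  ~ central_series b p Gam k.+2 (commutator_tower (x i0) (x i1) k).
Proof.
move=> p_pr bx i10 Hc; have [g [h [Ug Uh gh]]] := unitri_tower_neq1 k p_pr.
(* The target is the unitriangular group itself, since the filtration must be everything at index
   1. *)
pose U := Subgroup (unitri_set_subgroup p k.+1 1).
pose gU : subgroup_type U := SubgroupType (mem_set (Ug : (U : set _) g)).
pose hU : subgroup_type U := SubgroupType (mem_set (Uh : (U : set _) h)).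
have [f [fx _]] := @bx (subgroup_type U) (fun i => if i == i0 then gU else hU).
have valM : monoid.monoid_morphism (@subgroup_val _ U) by [].
pose v : Defs.hom (subgroup_type U) {unit 'M['F_p]_k.+2} :=
  HB.pack_for (Defs.hom (subgroup_type U) {unit 'M['F_p]_k.+2})
    (@subgroup_val _ U) (isUMagmaMorphism.Build _ _ (@subgroup_val _ U) valM).
apply: gh.
have <- : v (f (commutator_tower (x i0) (x i1) k)) = commutator_tower g h k.
  by rewrite !commutator_tower_morph !fx eqxx (negPf i10).
pose D i := [set y : subgroup_type U | unitri_set i (v y)].
have sD i : is_subgroup (D i).
  have [s1 sM sV] := unitri_set_subgroup p k.+1 i.
  split=> [|y z Hy Hz|y Hy]; rewrite /D /mkset ?gmulf1 ?gmulfM ?gmulfV //.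
    exact: sM.
  exact: sV.
have D1 y : D 1%N y by exact: set_mem (subgroup_valP y).
have : D k.+2 (f (commutator_tower (x i0) (x i1) k)).
  apply: (series_sub_filtration p_pr sD D1 _ _ _ (series_morph f Hc)).
  - by move=> i j ij y; exact: diag_ge_le.
  - move=> i y z Dy; rewrite /D /mkset gmulfR -[i.+1]add1n.
    by apply: unitri_set_commg => //; exact: D1.
  - by move=> i y Dy; rewrite /D /mkset gmulfXn; exact: unitri_set_pow.
(* No entry of a matrix of size k + 2 is at distance k + 2 from the diagonal. *)
move=> /(diag_ge_eq0 (ltnSn _)) /eqP; rewrite GRing.subr_eq0 => /eqP v1.
exact: val_inj.
Qed.

(** * Maps through F_p, translations and induced automorphisms *)

(** F_p is abelian of exponent p, so it admits the filtration that is trivial from index 2 on. *)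
Lemma hom_Fp_series2 (b : series_kind) (p : nat) (G : groupType)
    (f : Defs.hom G 'F_p) x :
  prime p -> central_series b p G 2 x -> f x = 1.
Proof.
move=> p_pr /(series_morph f).
pose D i := [set y : 'F_p | (1 < i)%N -> y = 1].
move=> Hf; suff : D 2 (f x) by apply.
apply: (series_sub_filtration p_pr _ _ _ _ _ Hf) => //.
- move=> i; split=> // [y z Dy Dz /[dup] /Dy -> /Dz ->|y Dy /Dy ->].
    by rewrite mulg1.
  by rewrite invg1.
- by move=> i j ij y Dy i1; apply: Dy; exact: leq_trans ij.
- by move=> i y z _ _; apply/eqP/commgP; exact: FinRing.zmod_mulgC.
- by move=> i y _ _; rewrite FinRing.zmodXgE GRing.mulrn_pchar ?pchar_Fp.
Qed.

Lemma Fp_pow_hom (p : nat) (G : groupType) (u : G) :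
  prime p -> u ^+ p = 1 ->
  exists f : Defs.hom 'F_p G, forall t : 'F_p, f t = u ^+ (t : nat).
Proof.
move=> p_pr up.
have umod j : u ^+ (j %% p) = u ^+ j.
  by rewrite [in RHS](divn_eq j p) mulnC expgnDr expgnA up expg1n mul1g.
pose f (t : 'F_p) := u ^+ (t : nat).
have fM : monoid.monoid_morphism f.
  split=> // s t; rewrite /f -expgnDr -[RHS]umod.
  by rewrite -[in X in _ %% X](Fp_cast p_pr).
by exists (HB.pack_for (Defs.hom 'F_p G) f (isUMagmaMorphism.Build _ _ f fM)).
Qed.

(** Since z kills its own image, v |-> z(v)^-1 v is the inverse map. *)
Lemma central_translation_aut (G : groupType) (z : Defs.hom G G) :
  (forall v w, commute (z v) w) -> (forall v, z (z v) = 1) ->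
  exists a : aut G, forall v, a v = z v * v.
Proof.
move=> zC zz; pose a v := z v * v; pose a' v := z v^-1 * v.
have aM : monoid.monoid_morphism a.
  split=> [|v w]; rewrite /a ?gmulf1 ?mulg1 // gmulfM.
  by rewrite -!mulgA; congr (_ * _); rewrite !mulgA; congr (_ * _); exact: zC.
have aK : cancel a a'.
  by move=> v; rewrite /a' /a gmulfV gmulfM zz mul1g mulKg.
have a'K : cancel a' a.
  by move=> v; rewrite /a' /a gmulfM zz mul1g gmulfV mulVKg.
pose ah : Defs.hom G G := HB.pack_for (Defs.hom G G) a
  (isUMagmaMorphism.Build _ _ a aM).
by exists (@Aut G ah a' aK a'K).
Qed.

Section InducedMaps.
Variables (b : series_kind) (p : nat) (Gam : groupType).
Local Notation series := (central_series b p Gam).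

Lemma cl_eq1 k x : cl b p Gam k x = 1 <-> series k.+1 x.
Proof.
have -> : 1 = cl b p Gam k 1 by rewrite gmulf1.
have [_ _ SV] := series_subgroup b p Gam k.+1.
by rewrite cl_eqP mulg1; split=> /SV; rewrite ?invgK.
Qed.

Lemma involution_aut k (f : Defs.hom Gam Gam) : involutive f ->
  exists a : aut (calN b p Gam k),
    forall x, a (cl b p Gam k x) = cl b p Gam k (f x).
Proof.
move=> fK.
have [g gE] := @quotient_hom Gam _ (series_nsub b p Gam k.+1)
  (cl b p Gam k \o f)
  (fun x Hx => (cl_eq1 k (f x)).2 (series_morph f Hx)).
have gK : involutive g.
  by move=> v; have [y <-] := coset_onto v; rewrite gE /= [LHS]gE /= fK.
by exists (@Aut _ g g gK gK).
Qed.

End InducedMaps.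

(** f is a composite N_1 -> F_p -> L_(k+1), the second map taking powers of the class u of c. The
    automorphism equal to [incl_fun f] guarantees that [incl f] is not its default value. *)
Lemma tower_translation (b : series_kind) (p n : nat) (Gam : groupType)
    (x : 'I_n -> Gam) (i0 i1 : 'I_n) (k : nat) (c : Gam) :
  prime p -> free_basis x -> i1 != i0 -> (0 < k)%N ->
  lower_central Gam k.+1 c ->
  exists2 f : ker_hom b p Gam k,
    (exists a : aut (calN b p Gam k.+1), a =1 incl_fun f) &
    (subgroup_val (f (cl b p Gam 1 (x i0))) = cl b p Gam k.+1 c /\
     subgroup_val (f (cl b p Gam 1 (x i1))) = 1).
Proof.
move=> p_pr bx i10 k0 cL; pose u := cl b p Gam k.+1 c.
have cS : central_series b p Gam k.+1 c by exact: lower_central_sub_series.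
have up : u ^+ p = 1.
  rewrite -gmulfXn; apply/cl_eq1/lower_central_pow_series => //.
  exact: prime_gt1.
have uC v : commute u v.
  have [y <-] := cl_onto v; apply/esym/commgP/eqP.
  rewrite -gmulfR; apply/cl_eq1.
  apply: (@lower_central_sub_series b p); apply: sub_gen.
  by exists y => //; exists c.
have uL : (calL b p Gam k.+1 : set _) u by exists c.
pose uT : subgroup_type (calL b p Gam k.+1) := SubgroupType (mem_set uL).
have valX m : subgroup_val (uT ^+ m) = u ^+ m.
  by elim: m => [|m IH] //; rewrite !expgS /= IH.
have uTp : uT ^+ p = 1 by apply: val_inj; exact: etrans (valX p) up.
have [h hE] := Fp_pow_hom p_pr uTp; have [g gE] := Fp_pow_hom p_pr up.
(* Here [1] is the group identity, the residue 0; [Zp1] is the residue 1. *)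
have [e [ex _]] := @bx 'F_p (fun i => if i == i0 then Zp1 else 1).
have e2 y : central_series b p Gam 2 y -> e y = 1 by exact: hom_Fp_series2.
have [e1 e1E] := @quotient_hom Gam _ (series_nsub b p Gam 2) e e2.
have [z zE] := @quotient_hom Gam _ (series_nsub b p Gam k.+2) (g \o e)
  (fun y Hy =>
    etrans (congr1 g (e2 y (series_le (isT : 2 <= k.+2)%N Hy))) gmulf1).
exists (h \o e1); last first.
  rewrite /= [e1 _]e1E [e1 _]e1E !ex eqxx (negPf i10) !hE.
  by split; [rewrite valX /= modn_small ?expg1|].
(* As k > 0, c lies in the second term of the series, which e kills; hence z o z is trivial. *)
have zu : z u = 1.
  by rewrite [z _]zE /= e2 ?gmulf1 //; exact: series_le cS.
have [v w|v|a aE] := @central_translation_aut _ z.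
- have [y <-] := cl_onto v; rewrite [z _]zE /= gE.
  by apply/commute_sym/commuteX/commute_sym.
- have [y <-] := cl_onto v; rewrite [z (cl _ _ _ _ _)]zE /= gE gmulfXn zu.
  exact: expg1n.
exists a => v; rewrite aE /incl_fun; have [y <-] := cl_onto v.
by rewrite [z _]zE /= gE proj_cl // [e1 _]e1E hE valX.
Qed.

Theorem proposition4p4p6 (p n : nat) (p_prime : prime p) (n_gt1 : (1 < n)%N)
    (Gam : groupType) (Gam_free : free_of_rank Gam n)
    (b : series_kind) (k : nat) (k_ge1 : (1 <= k)%N) :
  ~ central_extension (aut_extension b p Gam k).
Proof.
have [x bx] := Gam_free.
pose i0 : 'I_n := Ordinal (ltnW n_gt1); pose i1 : 'I_n := Ordinal n_gt1.
have i10 : i1 != i0 by [].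
pose c := commutator_tower (x i0) (x i1) k.
have [f [a aE] [f0 f1]] := tower_translation b p_prime bx i10 k_ge1
  (commutator_tower_lower_central (x i0) (x i1) k : lower_central Gam k.+1 c).
have [s sK sx] := free_basis_perm bx (tpermK i0 i1).
have [t tE] := involution_aut b p k.+1 sK.
move=> /(_ (incl f)) central.
have at_comm : commute a t.
  by rewrite -(inclE aE); apply: central; exists f.
(* At x_0, a t gives the class of x_1, while t a gives t u times that class. *)
have := congr1 (fun q : aut _ => q (cl b p Gam k.+1 (x i0))) at_comm.
rewrite /= tE sx tpermL !aE /incl_fun !proj_cl // f0 f1 mul1g.
rewrite gmulfM !tE sx tpermL => /esym /(canRL (mulgK _)); rewrite mulgV.
(* t u is the class of s(c); applying the involution s again puts c itself in the term of index k +
   2. *)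
move=> /cl_eq1 /(series_morph s); rewrite sK.
exact: tower_not_in_series.
Qed.
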